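(* Let $B=\{x\in\mathbb{R}^m : |x|\le 1\}$ be the unit closed ball in $\mathbb{R}^{m}$, with boundary $\partial B=\{x\in\mathbb{R}^m:|x|=1\}$. Then there does not exist a $C^{1}$-map $T:B\rightarrow\mathbb{R}^{m}$ such that $T(B)\subset\partial B$ and $T(x)=x$ for every $x\in\partial B$.
   Context: Here $|\cdot|$ is the Euclidean norm. A map $T:B\to\mathbb{R}^m$ is $C^1$ if it is continuous on $B$, continuously differentiable in the interior of $B$, and its first-order partial derivatives extend continuously to $B$. *)

(* Defs.v *)
From HB Require Import structures.
From mathcomp Require Import all_boot all_order all_algebra.
From mathcomp Require Import all_classical all_reals all_analysis.
Import Order.TTheory GRing.Theory Num.Theory.
Import numFieldNormedType.Exports.

Set Implicit Arguments.
Unset Strict Implicit.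
Unset Printing Implicit Defensive.

Local Open Scope classical_set_scope.
Local Open Scope ring_scope.

(* The library norm on ['rV[R]_m] is the sup norm; it induces the same topology
   as the Euclidean norm, but has a different unit ball. *)
Definition enorm (R : realType) (m : nat) (x : 'rV[R]_m) : R :=
  Num.sqrt (\sum_(i < m) x ord0 i ^+ 2).

Definition eball (R : realType) (m : nat) : set 'rV[R]_m :=
  [set x | enorm x <= 1].

Definition esphere (R : realType) (m : nat) : set 'rV[R]_m :=
  [set x | enorm x = 1].

Arguments eball : clear implicits.
Arguments esphere : clear implicits.

(* A map B -> R^n is represented by a total function whose values outside B are
   irrelevant: continuity on B is with respect to the subspace topology, and the
   derivatives are only taken at interior points of B. *)
Definition C1_on (R : realType) (m n : nat) (B : set 'rV[R]_m)
    (T : 'rV[R]_m -> 'rV[R]_n) : Prop :=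
  [/\ {within B, continuous T},
      forall x, B° x -> differentiable T x /\ {for x, continuous (jacobian T)}
    & forall i : 'I_m, exists G : 'rV[R]_m -> 'rV[R]_n,
        {within B, continuous G} /\
        forall x, B° x -> G x = 'D_(delta_mx ord0 i) T x].

(* Main.v *)
(** Only the continuity of T matters.  Extending T by the identity outside B
    gives a continuous F : R^m -> R^m with |F| >= 1 everywhere, while F is the
    identity on the faces of [-1, 1]^m, so F has a zero there by the
    Poincare-Miranda theorem.

    Poincare-Miranda is proved combinatorially.  On a fine grid, label each
    vertex by the signs of the coordinates of F: this gives 0-cochains
    l_1, ..., l_m with values in F_2, where l_i is 0 on the face x_i = 0 and 1
    on the opposite face.  By Stokes' formula and induction on m, the cubical
    cup product dl_1 u ... u dl_m sums to 1 over the grid, so it is nonzero on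
    some small cube, on which every coordinate of F changes sign.  By
    compactness such cubes cluster at a zero of F. *)
Require Import Defs.
From HB Require Import structures.
From mathcomp Require Import all_boot all_order all_algebra.
From mathcomp Require Import boolp.
Import Order.TTheory GRing.Theory Num.Theory.

Local Open Scope ring_scope.

(** * Cup products of cubical cochains in characteristic 2 *)

Section CubicalCochains.
Local Set Implicit Arguments.
Local Unset Strict Implicit.
Variables (I : finType) (K : comNzRingType).
Hypothesis char2 : 2%N \in [pchar K].
Variable lab : I -> (I -> nat) -> K.
Implicit Types (x y z : I -> nat) (A B : {set I}) (i j k : I) (s : seq I).

Definition incr i x : I -> nat := fun k => (x k + (k == i))%N.

Lemma incrC i j x : incr i (incr j x) = incr j (incr i x).
Proof. by apply/funext => k; rewrite /incr addnAC. Qed.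

(* [cup s A x] is the cup product of the coboundaries d(lab k), k in s, in this
   order, evaluated on the cube with lowest vertex x and directions A; it
   vanishes unless s and A have the same size. *)
Fixpoint cup s A x : K :=
  if s is k :: s' then
    \sum_(i in A) (lab k (incr i x) + lab k x) * cup s' (A :\ i) (incr i x)
  else (A == set0)%:R.

(** The terms of [(i, j)] and [(j, i)] are equal, so they cancel in characteristic 2. *)
Lemma sum_offdiag_sym0 A (f : I -> I -> K) : (forall i j, f i j = f j i) ->
  \sum_(i in A) \sum_(j in A :\ i) f i j = 0.
Proof.
move=> fC; have [n] := ubnP #|A|; elim: n A => // n IHn A leAn.
have [->|[a aA]] := set_0Vmem A; first by rewrite big_set0.
rewrite (big_setD1 a) //= [X in _ + X](eq_bigr (fun i => f a i +
    \sum_(j in A :\ a :\ i) f i j)); last first.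
  move=> i; rewrite !inE => /andP[ia iA].
  rewrite (big_setD1 a) ?inE ?[a == i]eq_sym ?ia ?aA //=.
  congr (_ + _); first exact: fC.
  by apply: eq_bigl => j; rewrite !inE andbCA.
rewrite big_split /= addrA addrr_pchar2 // add0r IHn //.
by move: leAn; rewrite ltnS (cardsD1 a) aA.
Qed.

Lemma exchange_offdiag A (f : I -> I -> K) :
  \sum_(i in A) \sum_(j in A :\ i) f i j =
  \sum_(i in A) \sum_(j in A :\ i) f j i.
Proof.
rewrite (exchange_big_dep (mem A)) /=; last by move=> i j _ /setD1P[].
apply: eq_bigr => i iA; apply: eq_bigl => j.
by rewrite !inE iA andbT eq_sym andbC.
Qed.

(* In characteristic 2 this says that the coboundary of the cochain [cup s] is
   zero. *)
Lemma cup_closed s A x :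
  \sum_(i in A) cup s (A :\ i) (incr i x) = \sum_(i in A) cup s (A :\ i) x.
Proof.
elim: s A x => [|k s IHs] A x; first by [].
pose l := lab k; pose w i j y := cup s (A :\ i :\ j) y.
have wC i j y : w i j y = w j i y.
  by rewrite /w; congr (cup s _ y); apply/setP => a; rewrite !inE andbCA.
pose D (f : I -> I -> K) := \sum_(i in A) \sum_(j in A :\ i) f i j.
have sumD f g : D (fun i j => f i j + g i j) = D f + D g.
  by rewrite /D -big_split; apply: eq_bigr => i _; rewrite big_split.
have DE f g : (forall i j, f i j = g i j) -> D f = D g.
  by move=> fg; apply: eq_bigr => i _; apply: eq_bigr.
have IH (c : I -> K) : D (fun i j => c i * w i j (incr j (incr i x))) =
    D (fun i j => c i * w i j (incr i x)).
  by apply: eq_bigr => i _; rewrite -!mulr_sumr IHs.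
transitivity (D (fun i j => l (incr j (incr i x)) * w i j (incr j (incr i x))
                 + l (incr i x) * w i j (incr j (incr i x)))).
  by apply: DE => i j /=; rewrite mulrDl.
rewrite sumD [X in X + _]sum_offdiag_sym0 ?add0r; last first.
  by move=> i j; rewrite incrC wC.
transitivity (D (fun i j => l (incr j x) * w i j (incr j x)
                 + l x * w i j (incr j x))); last first.
  by apply: DE => i j /=; rewrite mulrDl.
rewrite sumD IH [RHS]addrC.
(* After swapping [i] and [j], [IH] with a constant coefficient shifts the base point to
   [incr j (incr i x)], which makes the summand symmetric. *)
have -> : D (fun i j => l x * w i j (incr j x)) = 0.
  rewrite /D exchange_offdiag.
  rewrite -[LHS](DE (fun i j => l x * w i j (incr i x))); last first.
    by move=> i j; rewrite wC.
  by rewrite -IH; apply: sum_offdiag_sym0 => i j; rewrite incrC wC.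
by rewrite add0r /D exchange_offdiag; apply: DE => i j; rewrite wC.
Qed.

(* dl u w = d(l u w) since dw = 0: [cup (k :: s)] becomes a sum of differences
   of a single function along each direction. *)
Lemma cup_cons k s A x : cup (k :: s) A x =
  \sum_(i in A) (lab k (incr i x) * cup s (A :\ i) (incr i x) +
                 lab k x * cup s (A :\ i) x).
Proof.
rewrite big_split /= -mulr_sumr -cup_closed mulr_sumr -big_split.
by apply: eq_bigr => i _; rewrite /= mulrDl.
Qed.

Definition cube A x y := forall i, (x i <= y i <= x i + (i \in A))%N.

(** Some term of the defining sum is nonzero. Its first factor gives an edge on which the head label
    changes; its second factor is a cup product on a face of the cube and handles the other labels
    by induction. *)
Lemma cup_neq0 s A x k : cup s A x != 0 -> k \in s ->
  exists y z, [/\ cube A x y, cube A x z & lab k y != lab k z].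
Proof.
elim: s A x => [|k0 s IHs] A x //= /eqP s0; rewrite inE.
have [i iA wi0] : exists2 i, i \in A &
    (lab k0 (incr i x) + lab k0 x) * cup s (A :\ i) (incr i x) != 0.
  apply: contrapT => no; apply: s0; apply: big1 => i iA.
  by apply/eqP/negP => /negP ?; apply: no; exists i.
case/predU1P => [->|ks].
  exists (incr i x), x; split=> [j|j|].
  - rewrite /incr leq_addr leq_add2l /=.
    by case: eqP => // ->; rewrite iA.
  - by rewrite leqnn leq_addr.
  - by apply: contraNneq wi0 => ->; rewrite addrr_pchar2 ?mul0r.
have /IHs/(_ ks)[y [z [xy xz yz]]] : cup s (A :\ i) (incr i x) != 0.
  by apply: contraNneq wi0 => ->; rewrite mulr0.
have sub u : cube (A :\ i) (incr i x) u -> cube A x u.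
  move=> xu j; have := xu j; rewrite /incr !inE.
  case: eqP => [->|_] /=; first by rewrite iA addn0 addn1 => /andP[/ltnW-> ->].
  by rewrite addn0.
by exists y, z; split; auto.
Qed.

(** * Stokes' formula on a grid *)

Definition upd (T : Type) i (a : T) (x : I -> T) :=
  fun k => if k == i then a else x k.

Variable n : nat.
Notation grid := {ffun I -> 'I_n.+2}.
Definition vertex (f : grid) : I -> nat := fun i => f i.
(* The directions outside A are pinned at the upper end of the grid. *)
Definition face A (f : grid) := [forall i, (i \in A) == (f i < n.+1)%N].

(** On each grid line in direction [i] the sums are differences, by characteristic 2, and telescope
    to the two ends of the line. *)
Lemma sum_face_telescope A i (g : (I -> nat) -> K) : i \in A ->
  \sum_(f | face A f) (g (incr i (vertex f)) + g (vertex f)) =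
  \sum_(f | face (A :\ i) f) (g (vertex f) + g (upd i 0%N (vertex f))).
Proof.
move=> iA.
(* A vertex of [face A] is split into the upper end of its line in direction [i] and its height on
   that line; [h] reassembles the two. *)
pose h (u : grid * 'I_n.+1) : grid :=
  [ffun k => upd i (widen_ord (leqnSn _) u.2) u.1 k].
pose h' (f : grid) : grid * 'I_n.+1 :=
  ([ffun k => upd i ord_max f k], inord (f i)).
have hK u : (h' (h u) == u) = (u.1 i == ord_max).
  case: u => f a; rewrite /h' /h xpair_eqE !ffunE /= /upd eqxx /=.
  rewrite inord_val eqxx andbT.
  apply/eqP/eqP => [<-|fi]; first by rewrite ffunE eqxx.
  by apply/ffunP => k; rewrite !ffunE /upd; case: (k =P i) => // ->.
have h'K f : face A f -> h (h' f) = f.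
  move=> /forallP/(_ i); rewrite iA => /eqP/esym fi; apply/ffunP => k.
  rewrite !ffunE /upd; case: (k =P i) => [->|ki].
    by apply: val_inj; rewrite /= inordK.
  by rewrite !ffunE /upd; case: (k =P i).
rewrite (reindex_onto h h') //=.
rewrite (eq_bigl (fun u => face (A :\ i) u.1 && true)); last first.
  move=> [f a]; rewrite andbT hK; apply/andP/forallP => /=.
    move=> [/forallP fA /eqP fi] k; have := fA k; rewrite !inE ffunE /upd.
    by case: (eqVneq k i) => [->|//]; rewrite fi /= ltnn.
  move=> fA; split.
    apply/forallP => k; have := fA k; rewrite !inE ffunE /upd.
    by case: (eqVneq k i) => [->|//] _ /=; rewrite iA ltn_ord.
  have := fA i; rewrite !inE eqxx /= eq_sym => /eqP/negbT.
  rewrite -leqNgt => fi.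
  by rewrite -val_eqE /= eqn_leq fi -ltnS ltn_ord.
rewrite -(pair_big (fun f => face (A :\ i) f) xpredT
  (fun f a => g (incr i (vertex (h (f, a)))) + g (vertex (h (f, a))))) /=.
apply: eq_bigr => f /forallP/(_ i); rewrite !inE eqxx /= eq_sym => /eqP/negbT.
rewrite -leqNgt => fi.
pose F a := g (upd i a (vertex f)).
transitivity (\sum_(a < n.+1) (F a.+1 - F a)).
  apply: eq_bigr => a _; rewrite oppr_pchar2 //; congr (g _ + g _);
    apply/funext => k; rewrite /incr /vertex /h ffunE /upd;
    by case: (k =P i) => //= _; rewrite ?addn1 ?addn0.
rewrite -(big_mkord xpredT (fun a => F a.+1 - F a)) telescope_sumr //.
rewrite oppr_pchar2 //; congr (g _ + _); apply/funext => k.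
rewrite /upd /vertex; case: (k =P i) => // ->.
by apply/eqP; rewrite eqn_leq fi -ltnS ltn_ord.
Qed.

Hypothesis lab0 : forall i x, x i = 0%N -> lab i x = 0.
Hypothesis lab1 : forall i x, x i = n.+1 -> lab i x = 1.

Lemma sum_cup s : uniq s ->
  \sum_(f | face [set i in s] f) cup s [set i in s] (vertex f) = 1.
Proof.
elim: s => [|k s IHs] /=.
  move=> _; rewrite (big_pred1 [ffun=> ord_max]) /=.
    by rewrite (_ : [set _ in [::]] = set0) ?eqxx //;
       apply/setP => i; rewrite !inE.
  move=> f; apply/forallP/eqP => [f0|->] /=; last first.
    by move=> i; rewrite !inE ffunE /= ltnn.
  apply/ffunP => i; rewrite ffunE; have := f0 i.
  rewrite !inE eq_sym => /eqP/negbT; rewrite -leqNgt => fi.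
  by apply: val_inj; apply/eqP; rewrite eqn_leq fi -ltnS ltn_ord.
move=> /andP[ks us]; set A := [set i in k :: s].
have kA : k \in A by rewrite !inE eqxx.
have AE : A :\ k = [set i in s].
  apply/setP => i; rewrite !inE; case: (eqVneq i k) => // ->.
  by rewrite (negPf ks).
under eq_bigr do rewrite -/(cup (k :: s) A _) cup_cons.
rewrite exchange_big /=.
under eq_bigr => i iA do
  rewrite (sum_face_telescope (fun y => lab k y * cup s (A :\ i) y) iA).
(* Among the boundary terms, direction [k] gives the induction hypothesis: [lab k] is 1 at the upper
   end and 0 at the lower one. The other directions give 0. *)
rewrite (big_setD1 k) //= [X in _ + X]big1 ?addr0 => [|i].
  rewrite AE -[RHS](IHs us); apply: eq_bigr => f /forallP/(_ k).
  rewrite inE (negPf ks) eq_sym => /eqP/negbT; rewrite -leqNgt => fk.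
  rewrite [lab k (upd _ _ _)]lab0 ?mul0r ?addr0 /upd ?eqxx //.
  rewrite lab1 ?mul1r //; apply/eqP; rewrite /vertex eqn_leq fk andbT -ltnS.
  exact: ltn_ord.
rewrite AE inE => si.
(* The cube does not extend in direction [i], so [lab i] is constant on it, while [i] is in [s]. *)
have cup0 y : (y i = 0%N \/ y i = n.+1) -> cup s (A :\ i) y = 0.
  move=> yi; apply/eqP; apply: contrapT.
  move=> /negP /cup_neq0 /(_ si) [u [v [yu yv]]].
  have cubeE z : cube (A :\ i) y z -> z i = y i.
    move=> /(_ i); rewrite !inE eqxx addn0 => yz.
    by apply/eqP; rewrite eqn_leq andbC.
  case: yi => yi; move/eqP; apply.
    by rewrite !lab0 ?cubeE.
  by rewrite !lab1 ?cubeE.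
apply: big1 => f /forallP/(_ i); rewrite !inE eqxx eq_sym => /eqP/negbT.
rewrite -leqNgt => fi; rewrite !cup0 ?mulr0 ?addr0 //.
  by left; rewrite /upd eqxx.
by right; apply/eqP; rewrite /vertex eqn_leq fi andbT -ltnS; exact: ltn_ord.
Qed.

(** A sum equal to 1 has a nonzero term, and [cup_neq0] applies there to every label. *)
Lemma exists_fully_labelled_cube : exists2 x, forall i, (x i <= n)%N &
  forall k, exists y z, [/\ forall i, (x i <= y i <= (x i).+1)%N,
    forall i, (x i <= z i <= (x i).+1)%N & lab k y != lab k z].
Proof.
have := sum_cup (enum_uniq I).
have -> : [set i in enum I] = [set: I].
  by apply/setP => i; rewrite !inE mem_enum.
move=> S1; have [f fT f0] : exists2 f, face [set: I] f &
    cup (enum I) [set: I] (vertex f) != 0.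
  apply: contrapT => no; move: S1; rewrite big1 => [/eqP|f fT].
    by rewrite eq_sym oner_eq0.
  by apply/eqP/negP => /negP ?; apply: no; exists f.
exists (vertex f) => [i|k].
  by move/forallP/(_ i): fT; rewrite inE eq_sym ltnS => /eqP.
have [|y [z [fy fz yz]]] := cup_neq0 f0 (k := k); first by rewrite mem_enum.
have cubeT u i : cube [set: I] (vertex f) u ->
    (vertex f i <= u i <= (vertex f i).+1)%N.
  by move=> /(_ i); rewrite inE addn1.
by exists y, z; split=> // i; exact: cubeT.
Qed.
End CubicalCochains.

(* Imported only here because classical sets reuse the notations of finite
   sets. *)
From mathcomp Require Import all_classical all_reals all_analysis.
From mathcomp Require Import lra.
Import numFieldNormedType.Exports.

Local Open Scope classical_set_scope.

(** * The Poincare-Miranda theorem *)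

Section PoincareMiranda.
Variables (R : realType) (m : nat) (F : 'rV[R]_m -> 'rV[R]_m).
Hypothesis Fcont : continuous F.
Let Q : set 'rV[R]_m := [set x | forall i, `[-1, 1]%classic (x ord0 i)].
Hypothesis Flow : forall x i, Q x -> x ord0 i = -1 -> F x ord0 i <= 0.
Hypothesis Fhigh : forall x i, Q x -> x ord0 i = 1 -> 0 <= F x ord0 i.

Let node n (y : 'I_m -> nat) : 'rV[R]_m := \row_i (-1 + 2 * (y i)%:R / n.+1%:R).
(** Here [bool] serves as F_2. The values on the two extreme layers are forced because [F] may
    vanish on a face and because the boundary conditions on labels also concern points off the
    grid. *)
Let sgn_lab n (i : 'I_m) (y : 'I_m -> nat) : bool :=
  (y i == n.+1) || (y i != 0%N) && (0 < F (node n y) ord0 i).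

Let node_in n y : (forall i, (y i <= n.+1)%N) -> Q (node n y).
Proof.
move=> yn i; rewrite /= in_itv /= mxE.
have y1 : (y i)%:R / n.+1%:R <= 1 :> R by rewrite ler_pdivrMr // mul1r ler_nat.
have y0 : 0 <= (y i)%:R / n.+1%:R :> R by rewrite divr_ge0.
by rewrite -mulrA; move: (_ / _) y0 y1 => t t0 t1; apply/andP; split; lra.
Qed.

Lemma poincare_miranda : exists2 x, Q x & F x = 0.
Proof.
have /(_ _)/cid2-/all_sig2[x xn xlab] : forall n, exists2 x : 'I_m -> nat,
    forall i, (x i <= n)%N & forall k, exists y z,
    [/\ forall i, (x i <= y i <= (x i).+1)%N,
      forall i, (x i <= z i <= (x i).+1)%N & sgn_lab n k y != sgn_lab n k z].
  move=> n; apply: (@exists_fully_labelled_cube 'I_m bool) => //.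
    by move=> i y y0; rewrite /sgn_lab y0.
  by move=> i y yn; rewrite /sgn_lab yn eqxx.
pose a n := node n (x n).
have Qcompact : compact Q.
  apply: (@rV_compact R m (fun=> `[-1, 1]%classic)) => _.
  exact: segment_compact.
have [|z [Qz clz]] := Qcompact (a n @[n --> \oo]) _.
  by exists 0%N => // n _; apply: node_in => i; exact: leqW.
exists z => //; apply/rowP => i; rewrite [RHS]mxE; apply/eqP/negP => /negP Fz.
have Fi : {for z, continuous (fun y => F y ord0 i)}.
  apply: (continuous_comp (f := F) (g := fun M : 'rV[R]_m => M ord0 i)).
    exact: Fcont.
  exact: coord_continuous.
(* Positivity of [g y] says that coordinate [i] of [F] has the same sign at [y] as at [z]. *)
pose g y := F y ord0 i * F z ord0 i.
have : \forall y \near z, 0 < g y.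
  have gz : g y @[y --> z] --> g z.
    by rewrite /g; apply: (cvgM Fi); exact: cvg_cst.
  apply: (cvgr_gt _ gz).
  by rewrite /g -expr2 exprn_even_gt0.
case/nbhs_ballP => e /= e0 eg.
(* The cube at [a n] has side 2 / (n + 1) < e / 2 and [a n] is within e / 2 of [z], so all its
   vertices are within e of [z]. *)
have [b [[n [ne <-]] zan]] : [set a n | n in [set n | n.+1%:R^-1 < e / 4]] `&`
    ball z (e / 2) !=set0.
  apply: clz; last by apply: nbhsx_ballx; lra.
  have e4 : 0 < e / 4 by lra.
  by apply: filterS (near_infty_natSinv_lt (PosNum e4)) => n ne; exists n.
have [u [v [xu xv]]] := xlab n i.
suff lab y : (forall j, (x n j <= y j <= (x n j).+1)%N) ->
    sgn_lab n i y = (0 < F z ord0 i).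
  by rewrite !lab ?eqxx.
move=> xy.
have yn j : (y j <= n.+1)%N.
  by have /andP[_] := xy j => /leq_trans; apply; exact: xn.
have := eg (node n y); rewrite /g => /(_ _)/wrap[].
  split=> // j0 j; rewrite ord1; have [_ /(_ ord0 j)] := zan.
  rewrite /ball /= => zj.
  have /andP[xy1 xy2] := xy j.
  rewrite -(subrK (a n ord0 j) (z ord0 j)) -addrA.
  apply: le_lt_trans (ler_normD _ _) _.
  rewrite [e]splitr; apply: ltrD => //.
  rewrite !mxE opprD addrACA subrr add0r -!mulrA -mulrBr -mulrBl.
  have : `|((x n j)%:R - (y j)%:R : R)| <= 1.
    rewrite distrC ger0_norm ?subr_ge0 ?ler_nat //.
    by rewrite lerBlDr nat1r ler_nat.
  move=> xy3; rewrite !normrM (ger0_norm (ler0n _ 2)).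
  rewrite [`|_^-1|]ger0_norm ?invr_ge0 //.
  apply: (@le_lt_trans _ _ (2 * n.+1%:R^-1)).
    by rewrite ler_pM2l // ler_piMl ?invr_ge0.
  by move: ne => /=; move: (n.+1%:R^-1) => t; lra.
(* Only a forced value could disagree with the sign of [F], and then [Flow] or [Fhigh] contradicts
   that sign. *)
move=> gy; rewrite /sgn_lab; have Qy := node_in _ _ yn.
have nodei : node n y ord0 i = -1 + 2 * (y i)%:R / n.+1%:R by rewrite mxE.
have [Fz0|Fz0] := ltP 0 (F z ord0 i).
  have Fy : 0 < F (node n y) ord0 i by move: gy; rewrite pmulr_lgt0.
  rewrite Fy andbT; case: (eqVneq (y i) 0%N) => [yi0|]; last by rewrite orbT.
  have /(Flow _ i Qy) : node n y ord0 i = -1.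
    by rewrite nodei yi0 mulr0 mul0r addr0.
  by rewrite leNgt Fy.
have {}Fz0 : F z ord0 i < 0 by rewrite lt_neqAle Fz.
have Fy : F (node n y) ord0 i < 0 by move: gy; rewrite nmulr_lgt0.
rewrite ltNge (ltW Fy) andbF orbF; apply/eqP => yin.
have /(Fhigh _ i Qy) : node n y ord0 i = 1.
  by rewrite nodei yin mulfK ?pnatr_eq0 //; lra.
by rewrite leNgt Fy.
Qed.
End PoincareMiranda.

(** * Topology of the Euclidean norm *)

Section EuclideanNorm.
Context {R : realType} {m : nat}.

Lemma enorm_continuous : continuous (@enorm R m).
Proof.
have sum_cont : continuous (fun x : 'rV[R]_m => \sum_(i < m) x ord0 i ^+ 2).
  apply: (@continuous_big R _ _ _ _ (@add_continuous R)) => i _ y.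
  have c := @coord_continuous R 1 m ord0 i y.
  exact: (cvgM c c).
by move=> x; apply: continuous_comp; [exact: sum_cont|exact: sqrt_continuous].
Qed.

Lemma enorm_ge_coord (x : 'rV[R]_m) i : `|x ord0 i| <= enorm x.
Proof.
rewrite -sqrtr_sqr ler_wsqrtr // (bigD1 i) //= lerDl sumr_ge0 // => j _.
exact: sqr_ge0.
Qed.

Lemma closed_eball : closed (eball R m).
Proof.
rewrite (_ : eball R m = @enorm R m @^-1` [set r | r <= 1]) //.
by apply: closed_comp => [x _|]; [exact: enorm_continuous|exact: closed_le].
Qed.

Lemma closed_enorm_ge1 : closed [set x : 'rV[R]_m | 1 <= enorm x].
Proof.
rewrite (_ : mkset _ = @enorm R m @^-1` [set r | 1 <= r]) //.
by apply: closed_comp => [x _|]; [exact: enorm_continuous|exact: closed_ge].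
Qed.
End EuclideanNorm.

(** * Non-existence of a retraction onto the sphere *)

Theorem corollary3p3 (R : realType) (m : nat) :
  ~ exists T : 'rV[R]_m -> 'rV[R]_m,
      [/\ C1_on (eball R m) T,
          T @` eball R m `<=` esphere R m
        & forall x, esphere R m x -> T x = x].
Proof.
case=> T [[Tcont _ _] Tsphere Tid].
pose F x := if enorm x <= 1 then T x else x.
have Fout x : 1 <= enorm x -> F x = x.
  by rewrite le_eqVlt /F => /predU1P[x1|/lt_geF->//]; rewrite -x1 lexx Tid.
have Fcont : continuous F.
  apply/continuous_subspace_setT.
  (* Gluing over two closed sets; on their intersection, the sphere, [T] is the identity. *)
  rewrite (_ : setT = eball R m `|` [set x | 1 <= enorm x]); last first.
    apply/esym/seteqP; split=> // x _ /=.
    by case: (leP (enorm x) 1) => [|/ltW]; [left|right].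
  apply: withinU_continuous; [exact: closed_eball|exact: closed_enorm_ge1| |].
    apply: (@subspace_eq_continuous _ _ _ T F) Tcont => x; rewrite inE => x1.
    by rewrite /F ifT.
  apply: (@subspace_eq_continuous _ _ 'rV[R]_m id F); last first.
    by apply: continuous_subspaceT => x; exact: cvg_id.
  by move=> x; rewrite inE => /Fout ->.
have F1 x : 1 <= enorm (F x).
  rewrite /F; case: (leP (enorm x) 1) => [x1|/ltW//].
  by rewrite (Tsphere (T x)) //; exists x.
(* Each face of the cube [-1, 1]^m lies outside the open Euclidean ball. *)
have Fface (x : 'rV[R]_m) i : `|x ord0 i| = 1 -> F x = x.
  by move=> xi; apply: Fout; rewrite -xi enorm_ge_coord.
have [||x _ Fx0] := @poincare_miranda R m F Fcont.
- by move=> x i _ xi; rewrite (Fface x i) xi ?lerN10 // normrN1.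
- by move=> x i _ xi; rewrite (Fface x i) xi ?ler01 // normr1.
have := F1 x; rewrite Fx0 /enorm big1 ?sqrtr0 ?ler10 // => i _.
by rewrite mxE expr0n.
Qed.
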